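(* Let $G$ be any group, and suppose that for each $t\in\mathbf{Z}$ there is a homomorphism $p^t:G\to G^t$ from $G$ to a group $G^t$ (in general the group $G^t$ may be different for each $t$). Let $(G_\amalg,+)$ be the direct product group $\cdots\times G^t\times G^{t+1}\times\cdots$ over all $t\in\mathbf{Z}$. Then the map $p:G\to G_\amalg$ defined by $p(g)=(\ldots,p^t(g),p^{t+1}(g),\ldots)$ is a homomorphism from $G$ to $(G_\amalg,+)$, and $G/G_K\simeq\operatorname{im}p$, where $\operatorname{im}p$ is the image and $G_K$ the kernel of $p$. Moreover $\operatorname{im}p$ is a group system defined by a componentwise operation in $G^t$ for each $t\in\mathbf{Z}$. Lastly, $G\simeq\operatorname{im}p$ if and only if the kernel $G_K$ of the homomorphism $p$ is the identity.
   Context: A group system (with alphabet groups $G^t$, $t\in\mathbf{Z}$) is a set of sequences $(a^t)_{t\in\mathbf{Z}}$ with $a^t\in G^t$ that forms a group under the componentwise operation in the groups $G^t$. For groups or group systems, $A\simeq B$ means that there is a bijection $A\to B$ that preserves the group operation.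
   Formalization: In the last sentence, ''G ≃ im p'' is read as ''p itself is an isomorphism of G onto im p'', since with an arbitrary isomorphism the ''only if'' fails (G = B^ℕ with B nontrivial, every p^t the left shift: im p ≃ G but the kernel is nontrivial). *)

(* Defs.v *)
From HB Require Import structures.
From mathcomp Require Import all_boot ssrint generic_quotient.
From mathcomp Require Import boolp classical_sets.

Set Implicit Arguments.
Unset Strict Implicit.
Unset Printing Implicit Defensive.

Local Open Scope classical_set_scope.
Local Open Scope group_scope.
Local Open Scope quotient_scope.

Definition gisom (A B : groupType) (f : A -> B) : Prop :=
  bijective f /\ {morph f : x y / x * y}.

Definition gisog (A B : groupType) : Prop := exists f : A -> B, gisom f.

Section DirectProduct.
Variables (I : Type) (H : I -> groupType).

Definition dprodg : Type := forall i, H i.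

Definition dprodg_mul (a b : dprodg) : dprodg := fun i => a i * b i.
Definition dprodg_one : dprodg := fun i => 1.
Definition dprodg_inv (a : dprodg) : dprodg := fun i => (a i)^-1.

HB.instance Definition _ := gen_eqMixin dprodg.
HB.instance Definition _ := gen_choiceMixin dprodg.

Fact dprodg_mulA : associative dprodg_mul.
Proof.
by move=> a b c; apply: functional_extensionality_dep => i; exact: mulgA.
Qed.

Fact dprodg_mul1g : left_id dprodg_one dprodg_mul.
Proof.
by move=> a; apply: functional_extensionality_dep => i; exact: mul1g.
Qed.

Fact dprodg_mulg1 : right_id dprodg_one dprodg_mul.
Proof.
by move=> a; apply: functional_extensionality_dep => i; exact: mulg1.
Qed.

Fact dprodg_mulVg : left_inverse dprodg_one dprodg_inv dprodg_mul.
Proof.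
by move=> a; apply: functional_extensionality_dep => i; exact: mulVg.
Qed.

Fact dprodg_mulgV : right_inverse dprodg_one dprodg_inv dprodg_mul.
Proof.
by move=> a; apply: functional_extensionality_dep => i; exact: mulgV.
Qed.

HB.instance Definition _ := isGroup.Build dprodg
  dprodg_mulA dprodg_mul1g dprodg_mulg1 dprodg_mulVg dprodg_mulgV.

End DirectProduct.

(* The group axioms are spelled out for A and the componentwise operation, so *)
(* the identity of A is not assumed to be the identity sequence.              *)
Definition group_system (H : int -> groupType) (A : set (forall t, H t)) :
    Prop :=
  let op (a b : forall t, H t) : forall t, H t := fun t => a t * b t in
  [/\ forall a b, A a -> A b -> A (op a b),
      forall a b c, A a -> A b -> A c -> op a (op b c) = op (op a b) c
    & exists2 e, A e & forall a, A a ->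
        [/\ op e a = a, op a e = a
          & exists2 b, A b & op b a = e /\ op a b = e] ].

HB.mixin Record isConjClosed (G : groupType) (N : {pred G}) := {
  gpred_conj : forall x y : G, x \in N -> x ^ y \in N
}.

#[short(type="normalClosed")]
HB.structure Definition NormalClosed (G : groupType) :=
  {N of isConjClosed G N & GroupClosed G N}.

Section Quotient.
Variables (G : groupType) (N : normalClosed G).

Definition same_coset (x y : G) : bool := x^-1 * y \in (N : {pred G}).

Fact same_coset_refl : reflexive same_coset.
Proof. by move=> x; rewrite /same_coset mulVg gpred1. Qed.

Fact same_coset_sym : symmetric same_coset.
Proof. by move=> x y; rewrite /same_coset -[in LHS]gpredV invgM invgK. Qed.

Fact same_coset_trans : transitive same_coset.
Proof.
move=> y x z xy yz; rewrite /same_coset -(mulgK y x^-1) -mulgA.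
exact: gpredM.
Qed.

Canonical same_coset_equiv :=
  EquivRel same_coset same_coset_refl same_coset_sym same_coset_trans.

Definition quotg : Type := {eq_quot same_coset_equiv}.

HB.instance Definition _ := Choice.on quotg.
HB.instance Definition _ := EqQuotient.on quotg.

Fact quotg_repr x : same_coset x (repr (\pi_quotg x)).
Proof. by have /eqmodP := esym (reprK (\pi_quotg x)). Qed.

Definition quotg_mul : quotg -> quotg -> quotg := lift_op2 quotg mul.
Definition quotg_one : quotg := lift_cst quotg 1.
Definition quotg_inv : quotg -> quotg := lift_op1 quotg inv.

Fact pi_quotg_mul : {morph \pi_quotg : x y / x * y >-> quotg_mul x y}.
Proof.
move=> x y; unlock quotg_mul; apply/eqmodP => /=.
have := quotg_repr x; have := quotg_repr y; rewrite /same_coset.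
move: (repr _) (repr _) => x' y' yN xN; rewrite invgM.
have -> : y^-1 * x^-1 * (x' * y') = (x^-1 * x') ^ y * (y^-1 * y').
  by rewrite conjgE !mulgA mulgK.
by rewrite gpredM ?gpred_conj.
Qed.

Fact pi_quotg_inv : {morph \pi_quotg : x / x^-1 >-> quotg_inv x}.
Proof.
move=> x; unlock quotg_inv; apply/eqmodP => /=.
have := quotg_repr x; rewrite /same_coset; move: (repr _) => x' xN.
rewrite invgK -gpredV invgM invgK.
have -> : x' * x^-1 = (x^-1 * x') ^ x^-1.
  by rewrite conjgE invgK !mulgA mulgV mul1g.
by rewrite gpred_conj.
Qed.

Fact pi_quotg_one : \pi_quotg 1 = quotg_one.
Proof. by unlock quotg_one. Qed.

Fact quotg_mulA : associative quotg_mul.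
Proof.
elim/quotW=> x; elim/quotW=> y; elim/quotW=> z.
by rewrite -!pi_quotg_mul mulgA.
Qed.

Fact quotg_mul1g : left_id quotg_one quotg_mul.
Proof. by elim/quotW=> x; rewrite -pi_quotg_one -pi_quotg_mul mul1g. Qed.

Fact quotg_mulg1 : right_id quotg_one quotg_mul.
Proof. by elim/quotW=> x; rewrite -pi_quotg_one -pi_quotg_mul mulg1. Qed.

Fact quotg_mulVg : left_inverse quotg_one quotg_inv quotg_mul.
Proof.
by elim/quotW=> x; rewrite -pi_quotg_inv -pi_quotg_mul mulVg pi_quotg_one.
Qed.

Fact quotg_mulgV : right_inverse quotg_one quotg_inv quotg_mul.
Proof.
by elim/quotW=> x; rewrite -pi_quotg_inv -pi_quotg_mul mulgV pi_quotg_one.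
Qed.

HB.instance Definition _ := isGroup.Build quotg
  quotg_mulA quotg_mul1g quotg_mulg1 quotg_mulVg quotg_mulgV.

End Quotient.

Section KernelImage.
Variables (G H : groupType) (f : {multiplicative G -> H}).

Fact gmul_one : f 1 = 1.
Proof. by apply: (@mulgI _ (f 1)); rewrite -gmulfM !mulg1. Qed.

Fact gmul_inv x : f x^-1 = (f x)^-1.
Proof. by apply/esym/mulg1_eq; rewrite -gmulfM mulgV gmul_one. Qed.

Definition kerg : {pred G} := [pred x | f x == 1].

Fact kerg_mulg_closed : mulg_closed kerg.
Proof.
by move=> x y; rewrite !inE gmulfM => /eqP-> /eqP->; rewrite mulg1.
Qed.

Fact kerg_one : 1 \in kerg.
Proof. by rewrite inE gmul_one. Qed.

Fact kerg_invg_closed : invg_closed kerg.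
Proof. by move=> x; rewrite !inE gmul_inv => /eqP->; rewrite invg1. Qed.

Fact kerg_conj (x y : G) : x \in kerg -> x ^ y \in kerg.
Proof.
by rewrite !inE conjgE !gmulfM gmul_inv => /eqP->; rewrite mul1g mulVg.
Qed.

HB.instance Definition _ := isMulClosed.Build G kerg kerg_mulg_closed.
HB.instance Definition _ := isMul1Closed.Build G kerg kerg_one.
HB.instance Definition _ := isInvClosed.Build G kerg kerg_invg_closed.
HB.instance Definition _ := isConjClosed.Build G kerg kerg_conj.

Definition imgg : Type := set_type (range f).

HB.instance Definition _ := SubChoice.on imgg.

Fact range_group_closed : group_closed (fun y : H => y \in range f).
Proof.
split=> [|_ _ /set_mem[x _ <-] /set_mem[y _ <-]].
  by apply: mem_set; exists 1 => //; exact: gmul_one.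
by apply: mem_set; exists (x / y); rewrite // gmulfM gmul_inv.
Qed.

HB.instance Definition _ :=
  SubChoice_isSubGroup.Build H _ imgg range_group_closed.

(* An abstract isomorphism G -> imgg f does not force kerg f to be trivial: a *)
(* group can be isomorphic to its quotient by a nontrivial subgroup.  That    *)
(* f identifies G with its image is therefore gisom to_imgg, and not          *)
(* gisog G imgg.                                                              *)
Definition to_imgg (x : G) : imgg := Sub (f x) (mem_set (imageT f x)).

Fact val_to_imgg x : val (to_imgg x) = f x.
Proof. by []. Qed.

End KernelImage.

(* Main.v *)
Require Import Defs.
From HB Require Import structures.
From mathcomp Require Import all_boot ssrint.
From mathcomp Require Import generic_quotient.
From mathcomp Require Import boolp classical_sets.

Local Open Scope classical_set_scope.
Local Open Scope group_scope.

(** The map into the direct product is a homomorphism because multiplication there is componentwise.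
    Everything else holds for any homomorphism [f] into a group, or into a direct product for the
    group system. Two elements have the same image exactly when they lie in the same coset of the
    kernel ([same_coset_kerg]), so [f] induces an isomorphism from the quotient onto its image
    ([quotg_to_imgg_isom]). The corestriction of [f] to its image is an isomorphism once it is
    injective, that is, once the kernel is trivial ([to_imgg_isomP]). *)

(** [bijective] demands an inverse function: choice turns surjectivity into a right inverse, and
    injectivity makes it a left inverse too. *)
Lemma inj_surj_bij (A B : Type) (f : A -> B) :
  injective f -> (forall y, exists x, f x = y) -> bijective f.
Proof. by move=> f_inj /choice[g gK]; exists g => // x; apply: f_inj. Qed.

Section DirectProductMap.
Variables (I : Type) (G : groupType) (H : I -> groupType).
Variable (f : forall i, {multiplicative G -> H i}).

Definition dprodg_map (g : G) : dprodg H := fun i => f i g.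

Fact dprodg_mapM : {morph dprodg_map : x y / x * y}.
Proof.
by move=> x y; apply: functional_extensionality_dep => i; exact: gmulfM.
Qed.

HB.instance Definition _ :=
  isMultiplicative.Build G (dprodg H) dprodg_map dprodg_mapM.

End DirectProductMap.

Section FirstIsomorphism.
Variables (G H : groupType) (f : {multiplicative G -> H}).

(** Read from left to right this makes [f] well defined on cosets; from right to left it makes the
    induced map injective. *)
Lemma same_coset_kerg x y : same_coset (kerg f) x y = (f x == f y).
Proof.
rewrite /same_coset inE gmulfM gmul_inv.
by apply/eqP/eqP => [/(canRL (mulVKg _))->|->]; rewrite ?mulg1 ?mulVg.
Qed.

Lemma to_imggM : {morph to_imgg f : x y / x * y}.
Proof. by move=> x y; apply: val_inj; exact: gmulfM. Qed.

Lemma to_imgg_surj (y : imgg f) : exists x, to_imgg f x = y.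
Proof.
by have /set_mem[x _ fx] := valP y; exists x; apply: val_inj.
Qed.

(** Evaluating at the chosen representative postpones well-definedness to [quotg_to_imgg_pi]. *)
Definition quotg_to_imgg (q : quotg (kerg f)) : imgg f := to_imgg f (repr q).

Lemma quotg_to_imgg_pi x :
  quotg_to_imgg (\pi_(quotg (kerg f))%qT x) = to_imgg f x.
Proof.
apply: val_inj; apply/esym/eqP.
(* Up to conversion the goal compares [f x] with [f] at the representative of the class of [x]. *)
by rewrite -[_ == _]same_coset_kerg; exact: quotg_repr.
Qed.

Lemma quotg_to_imgg_isom : gisom quotg_to_imgg.
Proof.
split.
  apply: inj_surj_bij => [|y].
    elim/quotW=> x; elim/quotW=> y; rewrite !quotg_to_imgg_pi.
    by move=> /(congr1 val)/eqP fxy; apply/eqmodP; rewrite /= same_coset_kerg.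
  have [x <-] := to_imgg_surj y.
  by exists (\pi_(quotg (kerg f))%qT x); exact: quotg_to_imgg_pi.
elim/quotW=> x; elim/quotW=> y.
by rewrite -[_ * _]pi_quotg_mul !quotg_to_imgg_pi to_imggM.
Qed.

(** [to_imgg f] is always a surjective homomorphism, so only injectivity is at stake. *)
Lemma to_imgg_isomP :
  gisom (to_imgg f) <-> kerg f =i [pred g : G | g == 1].
Proof.
split=> [[/bij_inj f_inj _] x | ker1].
  rewrite !inE; apply/eqP/eqP => [fx1|->]; last exact: gmul_one.
  by apply: f_inj; apply: val_inj; rewrite !val_to_imgg fx1 gmul_one.
split; last exact: to_imggM.
apply: inj_surj_bij to_imgg_surj => x y /(congr1 val)/eqP.
(* Equal images put [x^-1 * y] in the kernel, so it equals 1. *)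
rewrite /= -same_coset_kerg /same_coset ker1 inE => /eqP.
by move=> /(canRL (mulVKg _)); rewrite mulg1.
Qed.

End FirstIsomorphism.

(** The componentwise operation is convertible to multiplication in [dprodg Gt], so the group laws
    come from there; closure holds because [f] preserves products, identity and inverses. *)
Lemma range_group_system (G : groupType) (Gt : int -> groupType)
    (f : {multiplicative G -> dprodg Gt}) : group_system (range f).
Proof.
split=> [_ _ [x _ <-] [y _ <-]|a b c _ _ _|].
- by exists (x * y) => //; exact: gmulfM.
- exact: (@mulgA (dprodg Gt)).
- exists (1 : dprodg Gt); first by exists 1 => //; exact: gmul_one.
  move=> _ [x _ <-]; split.
  + exact: (@mul1g (dprodg Gt)).
  + exact: (@mulg1 (dprodg Gt)).
  + exists (f x)^-1; first by exists x^-1 => //; exact: gmul_inv.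
    by split; [exact: (@mulVg (dprodg Gt))|exact: (@mulgV (dprodg Gt))].
Qed.

Theorem theorem34 (G : groupType) (Gt : int -> groupType)
    (pt : forall t : int, {multiplicative G -> Gt t}) :
  exists2 p : {multiplicative G -> dprodg Gt},
      forall g : G, p g = (fun t : int => pt t g)
    & [/\ gisog (quotg (kerg p)) (imgg p),
          group_system (range p)
        & gisom (to_imgg p) <-> kerg p =i [pred g : G | g == 1] ].
Proof.
exists (dprodg_map _ _ _ pt) => //; split.
- by exists (quotg_to_imgg _ _ _); exact: quotg_to_imgg_isom.
- exact: range_group_system.
- exact: to_imgg_isomP.
Qed.
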